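(* Let $k\ge 3$. In the vertex on-line ordered Ramsey game described below, builder has a strategy which ensures that, for every $n$, the colored ordered $(k-1)$-graph contains either a red copy of the ordered $(k-1)$-graph $F$ or a blue $K^{k-1}_n$ (a set of $n$ exposed vertices all of whose $(k-1)$-subsets are drawn and colored blue), using at most $s=O(n^{k-2})$ vertices, at most $r=O(n^{k-2})$ red edges, and at most $m=O(n^{2k-4})$ edges in total (the implied constants depending only on $k$).
   Context: The vertex on-line ordered Ramsey game is played by two players, builder and painter. Vertices are revealed one at a time, $v_1,v_2,\ldots$, and are ordered $v_1<v_2<\cdots$ by the time they are revealed. At stage $i+1$ a new vertex $v_{i+1}$ is revealed; then, for every $(k-2)$-subset $S$ of the existing vertices $v_1,\ldots,v_i$, builder decides, one by one, whether to draw the $(k-1)$-edge $S\cup\{v_{i+1}\}$; whenever builder draws such an edge, painter must immediately color it red or blue. $F$ is the ordered $(k-1)$-graph on vertices $a_1<a_2<\cdots<a_k$ with exactly the two edges $\{a_1,\ldots,a_{k-1}\}$ and $\{a_1,\ldots,a_{k-2},a_k\}$; a red copy of $F$ means exposed vertices $b_1<\cdots<b_k$ such that these two corresponding edges have been drawn and colored red. *)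

(* Defs.v *)
From mathcomp Require Import all_boot finmap.

Set Implicit Arguments.
Unset Strict Implicit.
Unset Printing Implicit Defensive.

Local Open Scope fset_scope.

Notation color := bool (only parsing).
Definition red : color := true.
Definition blue : color := false.

(* Vertices are natural numbers, in order of revelation (v_{i+1} is i).       *)
(* [pending] lists the (k-2)-sets that builder has not yet decided about in   *)
(* the current stage; [drawn] lists the edges drawn so far, oldest first.     *)
(* For a fixed order of presentation a position determines the whole history  *)
(* of the play.                                                               *)
Record position := Position {
  nverts : nat;
  pending : seq {fset nat};
  drawn : seq ({fset nat} * color)
}.

Definition start : position := Position 0 [::] [::].

(* The second argument is the edge under consideration. *)
Definition builder_strategy := position -> {fset nat} -> bool.
Definition painter_strategy := position -> {fset nat} -> color.

(* The rules do not fix the order in which the (k-2)-subsets of the existing  *)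
(* vertices come up in a stage; [ord i] is the order used when vertex i is    *)
(* revealed, the existing vertices being 0, ..., i-1.                         *)
Definition presentation_order (k : nat) (ord : nat -> seq {fset nat}) : Prop :=
  forall i, uniq (ord i) /\
    forall S : {fset nat},
      (S \in ord i) <-> #|` S| = k - 2 /\ (forall x, x \in S -> x < i).

Definition step (ord : nat -> seq {fset nat})
    (B : builder_strategy) (P : painter_strategy) (p : position) : position :=
  if pending p is T :: rest then
    let e := (nverts p).-1 |` T in
    Position (nverts p) rest
      (if B p e then rcons (drawn p) (e, P p e) else drawn p)
  else Position (nverts p).+1 (ord (nverts p)) (drawn p).

Definition play (ord : nat -> seq {fset nat})
    (B : builder_strategy) (P : painter_strategy) (t : nat) : position :=
  iter t (step ord B P) start.

(* a_{j+1} is j : 'I_k *)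
Definition F_edges (k : nat) : seq {set 'I_k} :=
  [:: [set i : 'I_k | i < k - 1];
      [set i : 'I_k | (i < k - 2) || (i == k - 1 :> nat)]].

Definition red_F (k : nat) (p : position) : Prop :=
  exists b : 'I_k -> nat,
    [/\ forall i j : 'I_k, i < j -> b i < b j,
        forall i, b i < nverts p
      & forall E : {set 'I_k}, E \in F_edges k ->
          ([fset b i | i in E], red) \in drawn p].

Definition blue_clique (k n : nat) (p : position) : Prop :=
  exists A : {fset nat},
    [/\ #|` A| = n,
        forall x, x \in A -> x < nverts p
      & forall e : {fset nat}, e `<=` A -> #|` e| = k - 1 ->
          (e, blue) \in drawn p].

Definition num_edges (p : position) : nat := size (drawn p).
Definition num_red (p : position) : nat :=
  count (fun ec : {fset nat} * color => ec.2 == red) (drawn p).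

Definition ensures (k : nat) (ord : nat -> seq {fset nat})
    (B : builder_strategy) (n s r m : nat) : Prop :=
  forall P : painter_strategy, exists t : nat,
    let p := play ord B P t in
    [/\ red_F k p \/ blue_clique k n p,
        nverts p <= s, num_red p <= r & num_edges p <= m].

Definition bigO (f g : nat -> nat) : Prop :=
  exists C : nat, forall n, f n <= C * g n.

(* Main.v *)
Require Import Defs.
From mathcomp Require Import all_boot finmap.
From mathcomp Require Import zify.

Local Open Scope fset_scope.

(** Call a vertex good if it is not the largest vertex of a red edge.  Builder
    draws [S + v] exactly when every vertex of [S] is good, so that the good
    vertices whose stage is over span only blue edges.  Removing the largest
    vertex sends red edges to (k-2)-sets of good vertices; two red edges with
    the same image form a red [F], so while there is none and fewer than [n]
    vertices are good, at most [n ^ (k-2)] edges are red and hence at most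
    [n ^ (k-2)] vertices are bad. *)

(** * Largest vertex of an edge and the set left after removing it *)

Definition emax (e : {fset nat}) : nat := \max_(x <- e) x.
Definition stem (e : {fset nat}) : {fset nat} := e `\ emax e.

Lemma emaxU1 (u : nat) (T : {fset nat}) :
  (forall x, x \in T -> x < u) -> emax (u |` T) = u.
Proof.
move=> ltTu; apply/eqP; rewrite eqn_leq; apply/andP; split.
  apply/bigmax_leqP_seq => x; rewrite in_fset1U => /orP[/eqP-> //|/ltTu/ltnW //].
by apply: (@leq_bigmax_seq _ _ _ id) => //; rewrite in_fset1U eqxx.
Qed.

Lemma stemU1 (u : nat) (T : {fset nat}) :
  (forall x, x \in T -> x < u) -> stem (u |` T) = T.
Proof.
move=> ltTu; rewrite /stem emaxU1 // fsetU1K //.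
by apply/negP => /ltTu; rewrite ltnn.
Qed.

Lemma emax_in (e : {fset nat}) : 0 < #|` e| -> emax e \in e.
Proof.
rewrite -[_ \in e]/(_ \in enum_fset e) /emax.
case: (enum_fset e) => // x s _.
elim: s x => [|y s IHs] x; first by rewrite big_seq1 mem_head.
rewrite big_cons /maxn; case: ifP => _; last exact: mem_head.
by rewrite inE IHs orbT.
Qed.

Lemma ltn_emax (e : {fset nat}) (x : nat) : x \in stem e -> x < emax e.
Proof.
rewrite in_fsetD1 ltn_neqAle => /andP[-> xe] /=.
by apply: (@leq_bigmax_seq _ _ _ id).
Qed.

(** A deliberate overcount: sets recur, and repeated picks give sets with fewer than [j] elements.
    In exchange the length is exactly a power, which is the form of the bounds sought. *)
Fixpoint ksets (j : nat) (s : seq nat) : seq {fset nat} :=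
  if j is j'.+1 then [seq x |` T | x <- s, T <- ksets j' s] else [:: fset0].

Lemma size_ksets (j : nat) (s : seq nat) : size (ksets j s) = size s ^ j.
Proof. by elim: j => //= j IHj; rewrite size_allpairs IHj expnS. Qed.

Lemma mem_ksets (s : seq nat) (T : {fset nat}) :
  {subset T <= s} -> T \in ksets #|` T| s.
Proof.
move: {2}#|` T| (erefl #|` T|) => j; elim: j T => [|j IHj] T.
  by move=> T0 _; rewrite T0 (cardfs0_eq T0) /= inE.
move=> Tj sub; rewrite Tj.
have /fset0Pn[x xT] : T != fset0 by rewrite -cardfs_gt0 Tj.
have Tj' : #|` T `\ x| = j by have := cardfsD1 x T; rewrite xT Tj; lia.
have -> : T = x |` (T `\ x) by rewrite fsetD1K.
apply: allpairs_f; first exact: sub.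
by rewrite -{1}Tj'; apply: IHj => // y; rewrite in_fsetD1 => /andP[_ /sub].
Qed.

(** * The greedy strategy and its invariant *)

Section Strategy.

Context (k : nat) (ord : nat -> seq {fset nat}).
Hypotheses (hk : 3 <= k) (ordP : presentation_order k ord).

Definition reds (D : seq ({fset nat} * color)) : seq {fset nat} :=
  [seq ec.1 | ec <- D & ec.2].

Definition good (D : seq ({fset nat} * color)) (v : nat) : bool :=
  v \notin map emax (reds D).

(** The latest vertex is left out: its stage may still be running, so it can yet turn bad or have
    edges undecided. *)
Definition goods (p : position) : seq nat :=
  [seq v <- iota 0 (nverts p).-1 | good (drawn p) v].

(** The latest vertex is exempt from the test, so its stage goes on unchanged even after a red edge
    has made it bad. *)
Definition greedy : builder_strategy := fun p e =>
  all (fun x => (x == (nverts p).-1) || good (drawn p) x) e.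

Lemma ord_lt (v : nat) (T : {fset nat}) :
  T \in ord v -> forall x, x \in T -> x < v.
Proof. by case: (ordP v) => _ H /H[]. Qed.

Lemma ord_card (v : nat) (T : {fset nat}) : T \in ord v -> #|` T| = k - 2.
Proof. by case: (ordP v) => _ H /H[]. Qed.

Lemma mem_ord (v : nat) (T : {fset nat}) :
  #|` T| = k - 2 -> (forall x, x \in T -> x < v) -> T \in ord v.
Proof. by case: (ordP v) => _ H ? ?; apply/H. Qed.

(** Apart from pending sets, the drawn edges are exactly the sets T + v with T good. Goodness is
    read in the current position rather than when T + v came up; the two agree because the vertices
    of T are older than v and their status no longer changes. *)
Record greedy_inv (p : position) : Prop := GreedyInv {
  inv_uniq : uniq (map fst (drawn p));
  inv_pending_uniq : uniq (pending p);
  inv_pending : forall T, T \in pending p ->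
    [/\ 0 < nverts p, T \in ord (nverts p).-1
      & (nverts p).-1 |` T \notin map fst (drawn p)];
  inv_drawn : forall e, e \in map fst (drawn p) ->
    exists v T, [/\ e = v |` T, v < nverts p, T \in ord v
                  & forall x, x \in T -> good (drawn p) x];
  inv_complete : forall v T, v < nverts p -> T \in ord v ->
    (forall x, x \in T -> good (drawn p) x) ->
    (v = (nverts p).-1 /\ T \in pending p) \/ v |` T \in map fst (drawn p)
}.

(** A new edge can spoil only its own largest vertex, so the status of a vertex is frozen once its
    stage is over. *)
Lemma good_rcons (D : seq ({fset nat} * color)) (e : {fset nat}) (c : color)
    (x : nat) : x < emax e -> good (rcons D (e, c)) x = good D x.
Proof.
move=> xe; rewrite /good /reds filter_rcons /=; case: c => //.
by rewrite !map_rcons mem_rcons inE (ltn_eqF xe).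
Qed.

Lemma greedy_inv_step (P : painter_strategy) (p : position) :
  greedy_inv p -> greedy_inv (step ord greedy P p).
Proof.
case: p => N [|T rest] D [/= uD uP pP dP cP]; rewrite /step /=.
  split => //=.
  - by case: (ordP N).
  (* The new edges have largest vertex [N], which no edge drawn earlier reaches. *)
  - move=> T TN; split=> //; apply/negP => /dP[v [T' [eq_e vN T'v _]]].
    have := emaxU1 _ _ (ord_lt _ _ TN); rewrite eq_e emaxU1.
      by move=> vE; rewrite vE ltnn in vN.
    exact: ord_lt T'v.
  - by move=> e /dP[v [T [-> vN Tv gT]]]; exists v, T; split=> //; lia.
  - move=> v T; rewrite ltnS leq_eqVlt => /orP[/eqP->|vN] Tv gT; first by left.
    by right; case: (cP _ _ vN Tv gT) => // -[].
have [N0 Tord eD] := pP T (mem_head _ _); have ltT := ord_lt _ _ Tord.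
have ltN x : x \in T -> x < emax (N.-1 |` T) by rewrite emaxU1 //; apply: ltT.
case/andP: uP => Trest urest; set e := N.-1 |` T in eD ltN *.
(* Removing the latest vertex recovers the presented set, so distinct pending sets give distinct
   edges. *)
have Prest T' : T' \in rest -> N.-1 |` T' != e.
  move=> T'r; apply: contraNneq Trest => eqe.
  have [] := pP T'; first by rewrite inE T'r orbT.
  by move=> _ T'o _; rewrite -(stemU1 _ _ ltT) -/e -eqe stemU1 //; apply: ord_lt.
have BE : greedy (Position N (T :: rest) D) e = all (good D) T.
  apply/allP/allP => H x xT /=.
    have := H x; rewrite in_fset1U xT orbT => /(_ isT) /orP[/eqP xN|//].
    by have := ltT _ xT; rewrite xN ltnn.
  move: xT; rewrite in_fset1U => /orP[->//|/H /= ->]; exact: orbT.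
rewrite BE; case: allP => gT.
  have gE v T' x : v < N -> T' \in ord v -> x \in T' ->
      good (rcons D (e, P (Position N (T :: rest) D) e)) x = good D x.
    move=> vN T'v xT'; apply: good_rcons; rewrite emaxU1 //.
    by have := ord_lt _ _ T'v _ xT'; lia.
  split => //=.
  - by rewrite map_rcons rcons_uniq eD.
  - move=> T' T'r; have [|_ T'o T'D] := pP T'; first by rewrite inE T'r orbT.
    by split=> //; rewrite map_rcons mem_rcons inE negb_or Prest.
  - move=> e'; rewrite map_rcons mem_rcons inE => /orP[/eqP->|].
      exists N.-1, T; split=> //; first by rewrite ltn_predL.
      by move=> x xT; rewrite (gE N.-1 T) ?ltn_predL //; apply: gT.
    case/dP=> v [T' [-> vN T'v gT']]; exists v, T'; split=> // x xT'.
    by rewrite (gE v T') //; apply: gT'.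
  - move=> v T' vN T'v gT'; rewrite map_rcons mem_rcons inE.
    case: (cP v T') => // [x xT'|[-> ]|->]; last by right; rewrite orbT.
      by rewrite -(gE v T') //; apply: gT'.
    by rewrite inE => /orP[/eqP->|]; [right; rewrite eqxx|left].
split => //=.
- by move=> T' T'r; apply: pP; rewrite inE T'r orbT.
- move=> v T' vN T'v gT'; case: (cP v T') => // [[->]|]; last by right.
  by rewrite inE => /orP[/eqP TE|]; [case: gT; rewrite -TE|left].
Qed.

Lemma greedy_inv_play (P : painter_strategy) (t : nat) :
  greedy_inv (play ord greedy P t).
Proof. by elim: t => [|t IHt]; [split | apply: greedy_inv_step]. Qed.

(** * From repeated stems to a red [F], and from good vertices to a blue clique *)

Lemma sub_reds (D : seq ({fset nat} * color)) : {subset reds D <= map fst D}.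
Proof. exact: (mem_subseq (map_subseq _ (filter_subseq _ _))). Qed.

Lemma mem_reds (D : seq ({fset nat} * color)) (e : {fset nat}) :
  (e \in reds D) = ((e, red) \in D).
Proof.
apply/mapP/idP => [[[e' c]]|eD]; last by exists (e, red) => //; rewrite mem_filter.
by rewrite mem_filter => /andP[/= -> H ->].
Qed.

Lemma num_redE (p : position) : num_red p = size (reds (drawn p)).
Proof.
by rewrite /num_red size_map size_filter; apply: eq_count => -[e []].
Qed.

(** A boolean condition sufficient for builder's goal, so that a first time at which it holds can be
    taken. *)
Definition settled (n : nat) (p : position) : bool :=
  (n <= size (goods p)) || ~~ uniq (map stem (reds (drawn p))).

Lemma red_F_stem (p : position) (v w : nat) (T : {fset nat}) :
  v < w < nverts p -> T \in ord v ->
  (v |` T, red) \in drawn p -> (w |` T, red) \in drawn p -> red_F k p.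
Proof.
move=> /andP[vw wN] Tv vT wT; have ltT := ord_lt _ _ Tv.
(* The copy of [F] lists [T] in increasing order, then [v] at index [k - 2] and [w] at index
   [k - 1]. *)
pose s := sort leq T; pose b := s ++ [:: v; w].
have memT x : (x \in s) = (x \in T) by rewrite mem_sort.
have szs : size s = k - 2 by rewrite size_sort (ord_card _ _ Tv).
have szb : size b = k by rewrite size_cat szs /=; lia.
have sb : sorted ltn b.
  rewrite (sorted_pairwise ltn_trans) pairwise_cat /= vw !andbT.
  apply/andP; split.
    apply/allrelP => x y; rewrite memT !inE => /ltT xv /orP[]/eqP-> //.
    exact: ltn_trans vw.
  rewrite -(sorted_pairwise ltn_trans) ltn_sorted_uniq_leq sort_uniq fset_uniq.
  exact/sort_sorted/leq_total.
have bs i : i < k - 2 -> nth 0 b i \in T.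
  by move=> ik; rewrite nth_cat szs ik -memT mem_nth ?szs.
have bv : nth 0 b (k - 2) = v by rewrite nth_cat szs ltnn subnn.
have bw : nth 0 b (k - 1) = w.
  by rewrite nth_cat szs ifN; [have -> : k - 1 - (k - 2) = 1 by lia | lia].
have bT x : x \in T -> exists2 i, i < k - 2 & nth 0 b i = x.
  rewrite -memT => xs; exists (index x s); first by rewrite -szs index_mem.
  by rewrite nth_cat index_mem xs nth_index.
exists (fun i : 'I_k => nth 0 b i); split.
- by move=> i j ij; apply: (sorted_ltn_nth ltn_trans) => //; rewrite inE szb.
- move=> i; have : nth 0 b i \in b by rewrite mem_nth ?szb.
  rewrite mem_cat memT !inE => /orP[/ltT|/orP[]/eqP->]; lia.
move=> E /=; rewrite !inE => /orP[]/eqP->.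
- suff -> : [fset nth 0 b (nat_of_ord i) | i in [set i : 'I_k | i < k - 1]] = v |` T by [].
  apply/fsetP => x; rewrite in_fset1U; apply/imfsetP/orP => /=.
    move=> [i]; rewrite inE => ik ->.
    have [/bs|ik2] := ltnP i (k - 2); first by right.
    by left; apply/eqP; rewrite -bv; congr nth; lia.
  case=> [/eqP->|/bT[i ik <-]].
    have ik : k - 2 < k by lia.
    by exists (Ordinal ik); rewrite ?inE //=; lia.
  have ik' : i < k by lia.
  by exists (Ordinal ik'); rewrite ?inE //=; lia.
- suff -> : [fset nth 0 b (nat_of_ord i) | i in
      [set i : 'I_k | (i < k - 2) || (i == k - 1 :> nat)]] = w |` T by [].
  apply/fsetP => x; rewrite in_fset1U; apply/imfsetP/orP => /=.
    move=> [i]; rewrite inE => /orP[/bs ?|/eqP ik] ->; first by right.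
    by left; rewrite ik bw.
  case=> [/eqP->|/bT[i ik <-]].
    have ik : k - 1 < k by lia.
    by exists (Ordinal ik); rewrite ?inE //= eqxx orbT.
  have ik' : i < k by lia.
  by exists (Ordinal ik'); rewrite ?inE //= ik.
Qed.

Lemma reds_uniq (p : position) : greedy_inv p -> uniq (reds (drawn p)).
Proof.
by move=> /inv_uniq; apply: subseq_uniq; apply: map_subseq; apply: filter_subseq.
Qed.

Lemma red_F_nuniq (p : position) : greedy_inv p ->
  ~~ uniq (map stem (reds (drawn p))) -> red_F k p.
Proof.
move=> inv; have uR := reds_uniq _ inv.
case/(uniqPn fset0) => i [j [ij]]; rewrite size_map => jR.
have iR := ltn_trans ij jR.
have eR l : l < size (reds (drawn p)) -> exists v T,
    [/\ nth fset0 (reds (drawn p)) l = v |` T, v < nverts p, T \in ord v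
      & (v |` T, red) \in drawn p].
  move=> /(mem_nth fset0) lR; have := lR; rewrite mem_reds.
  have [v [T [-> ? ? _]]] := inv_drawn _ inv _ (sub_reds _ _ lR).
  by exists v, T.
rewrite !(nth_map fset0) //.
have [v [T [ei vN Tv vT]]] := eR _ iR; have [w [U [ej wN Uw wU]]] := eR _ jR.
have : nth fset0 (reds (drawn p)) i != nth fset0 (reds (drawn p)) j.
  by rewrite nth_uniq // neq_ltn ij.
rewrite ei ej stemU1; last exact: ord_lt Tv.
rewrite stemU1; last exact: ord_lt Uw.
move=> neq TU; subst U.
case: (ltngtP v w) => [vw|wv|eqvw].
- by apply: (red_F_stem p v w T) => //; rewrite vw.
- by apply: (red_F_stem p w v T) => //; rewrite wv.
- by rewrite eqvw eqxx in neq.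
Qed.

Lemma mem_goods (p : position) (x : nat) :
  (x \in goods p) = (x < (nverts p).-1) && good (drawn p) x.
Proof. by rewrite mem_filter mem_iota andbC. Qed.

(** An edge inside [goods p] came up in the finished stage of its largest vertex with a good stem,
    hence was drawn; red would have made that largest vertex bad. *)
Lemma blue_clique_goods (n : nat) (p : position) : greedy_inv p ->
  n <= size (goods p) -> blue_clique k n p.
Proof.
move=> inv nG; have sub : {subset take n (goods p) <= goods p}.
  by apply: mem_subseq; apply: take_subseq.
exists [fset x in take n (goods p)]; split.
- rewrite card_fseq undup_id ?size_takel // take_uniq //.
  by rewrite filter_uniq // iota_uniq.
- by move=> x; rewrite !inE => /sub; rewrite mem_goods => /andP[]; lia.
move=> e /fsubsetP eA ek.
have eG x : x \in e -> x \in goods p by move=> /eA; rewrite !inE => /sub.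
have me : emax e \in e by apply: emax_in; lia.
have := eG _ me; rewrite mem_goods => /andP[mN mg].
have eE : e = emax e |` stem e by rewrite fsetD1K.
have so : stem e \in ord (emax e).
  by apply: mem_ord; [have := cardfsD1 (emax e) e; rewrite me ek /stem; lia
                     | exact: ltn_emax].
(* The pending alternative fails because [emax e] is below the latest vertex. *)
case: (inv_complete _ inv _ _ _ so) => [|x|[]|]; [lia | | lia |].
  by rewrite in_fsetD1 => /andP[_ /eG]; rewrite mem_goods => /andP[].
rewrite -eE => /mapP[[e' c] ecD /= e'E]; move: ecD; rewrite -e'E.
case: c => // eD; have : e \in reds (drawn p) by rewrite mem_reds.
by move=> /(map_f emax); rewrite (negPf mg).
Qed.

(** * Bounds that hold as long as the position is unsettled *)

Lemma drawn_ksets (p : position) (v : nat) (T : {fset nat}) :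
  v < nverts p -> T \in ord v -> (forall x, x \in T -> good (drawn p) x) ->
  T \in ksets (k - 2) (goods p).
Proof.
move=> vN Tv gT; rewrite -(ord_card _ _ Tv); apply: mem_ksets => x xT.
by rewrite mem_goods gT // andbT; have := ord_lt _ _ Tv _ xT; lia.
Qed.

Lemma num_red_unsettled (n : nat) (p : position) :
  greedy_inv p -> ~~ settled n p -> num_red p <= n ^ (k - 2).
Proof.
move=> inv; rewrite negb_or -ltnNge negbK => /andP[Gn uS].
apply: (@leq_trans (size (goods p) ^ (k - 2))); last first.
  by rewrite leq_exp2r ?subn_gt0 // ltnW.
rewrite num_redE -size_ksets -(size_map stem); apply: uniq_leq_size => // S.
case/mapP => e /sub_reds/(inv_drawn _ inv)[v [T [-> vN Tv gT]]] ->.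
by rewrite stemU1; [exact: drawn_ksets vN Tv gT | exact: ord_lt Tv].
Qed.

Lemma nverts_unsettled (n : nat) (p : position) :
  greedy_inv p -> ~~ settled n p -> nverts p <= n + n ^ (k - 2).
Proof.
move=> inv st; have := num_red_unsettled _ _ inv st.
move: st; rewrite negb_or -ltnNge num_redE => /andP[Gn _] Rn.
(* The latest vertex, missing from [goods p], is paid for by the strict inequality
   [size (goods p) < n]. Each bad vertex is the [emax] of some red edge. *)
suff : (nverts p).-1 <= size (goods p) + size (reds (drawn p)) by lia.
rewrite -[X in X <= _](size_iota 0) -(count_predC (good (drawn p))).
rewrite -size_filter leq_add2l -size_filter -(size_map emax).
apply: uniq_leq_size; first by rewrite filter_uniq // iota_uniq.
by move=> x; rewrite mem_filter /= negbK => /andP[].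
Qed.

Lemma num_edges_unsettled (n : nat) (p : position) : greedy_inv p ->
  ~~ settled n p -> num_edges p <= (n + n ^ (k - 2)) * n ^ (k - 2).
Proof.
move=> inv st; have Nn := nverts_unsettled _ _ inv st.
move: st; rewrite negb_or -ltnNge => /andP[Gn _].
apply: (@leq_trans (nverts p * size (goods p) ^ (k - 2))); last first.
  by rewrite leq_mul // leq_exp2r ?subn_gt0 // ltnW.
rewrite -size_ksets -{1}(size_iota 0 (nverts p)).
rewrite -(size_allpairs (fun u T => u |` T)) /num_edges -(size_map fst).
apply: uniq_leq_size => [|e]; first exact: inv_uniq.
case/(inv_drawn _ inv) => v [T [-> vN Tv gT]].
by apply: allpairs_f; [rewrite mem_iota | exact: drawn_ksets vN Tv gT].
Qed.

(** * Termination and the final bounds *)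

Lemma nverts_unbounded (B : builder_strategy) (P : painter_strategy) (N : nat) :
  exists t, N <= nverts (play ord B P t).
Proof.
elim: N => [|N [t Nt]]; first by exists 0.
(* Each decision shortens the pending list, so every stage ends and a further vertex appears. *)
move: {2}(size _) (erefl (size (pending (play ord B P t)))) => l.
elim: l t Nt => [|l IHl] t Nt.
  move=> pt; exists t.+1; rewrite /play iterS -/(play ord B P t) /step.
  by move: Nt pt; case: (play ord B P t) => M [].
move=> pt; apply: (IHl t.+1); rewrite /play iterS -/(play ord B P t) /step;
  by move: Nt pt; case: (play ord B P t) => M [|T r] D //= ? [].
Qed.

Lemma step_growth (B : builder_strategy) (P : painter_strategy) (p : position) :
  let q := step ord B P p in
  [/\ nverts q <= (nverts p).+1, num_red q <= (num_red p).+1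
    & num_edges q <= (num_edges p).+1].
Proof.
rewrite /step /num_red /num_edges; case: p => N [|T r] D //=.
case: ifP => _; split; rewrite ?size_rcons // -cats1 count_cat /= addn0 -addn1.
by rewrite leq_add2l; case: (_ == _).
Qed.

Lemma greedy_ensures (n : nat) :
  ensures k ord greedy n (3 * n ^ (k - 2)) (2 * n ^ (k - 2)) (3 * n ^ (2 * k - 4)).
Proof.
move=> P; have inv := greedy_inv_play P.
(* For [n = 0] the bounds are all 0, and the empty clique is there at the start. *)
have [n0|n0] := posnP n.
  exists 0; split=> //; right; apply: blue_clique_goods; first exact: inv.
  by rewrite n0.
have ex : exists t, settled n (play ord greedy P t).
  have [t Nt] := nverts_unbounded greedy P (n + n ^ (k - 2)).+1.
  exists t; apply/negPn/negP => /(nverts_unsettled _ _ (inv t)); lia.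
(* At the first settled time [t], which is positive as [n > 0], each count exceeds its value in the
   preceding unsettled position by at most 1. With [x = n ^ (k - 2)] and [1 <= n <= x] this gives
   [n + x + 1 <= 3 * x], [x + 1 <= 2 * x] and [(n + x) * x + 1 <= 3 * x * x]. *)
case: (ex_minnP ex) => t st tmin; exists t; split.
  case/orP: st => st; first by right; apply: blue_clique_goods.
  by left; apply: red_F_nuniq.
all: have nk : n <= n ^ (k - 2) by rewrite -{1}(expn1 n) leq_pexp2l //; lia.
all: have nkk : n ^ (2 * k - 4) = n ^ (k - 2) * n ^ (k - 2)
       by rewrite -expnD; congr expn; lia.
all: case: t st tmin => [//|t] _ tmin.
all: have /negP nst : ~ settled n (play ord greedy P t)
       by move=> /tmin; rewrite ltnn.
all: have [] := step_growth greedy P (play ord greedy P t).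
all: rewrite [play _ _ _ t.+1]iterS -/(play ord greedy P t) => hN hR hE.
- by have := nverts_unsettled _ _ (inv t) nst; lia.
- by have := num_red_unsettled _ _ (inv t) nst; lia.
- have := num_edges_unsettled _ _ (inv t) nst.
  by rewrite nkk; move: hE nk n0; set x := n ^ _; nia.
Qed.

End Strategy.

Theorem theorem2p1 (k : nat) (hk : 3 <= k) :
  exists s r m : nat -> nat,
    [/\ bigO s (fun n => n ^ (k - 2)),
        bigO r (fun n => n ^ (k - 2))
      & bigO m (fun n => n ^ (2 * k - 4))] /\
    forall ord : nat -> seq {fset nat}, presentation_order k ord ->
      exists B : builder_strategy,
        forall n : nat, ensures k ord B n (s n) (r n) (m n).
Proof.
exists (fun n => 3 * n ^ (k - 2)), (fun n => 2 * n ^ (k - 2)),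
  (fun n => 3 * n ^ (2 * k - 4)); split.
  by split; [exists 3 | exists 2 | exists 3].
(* [greedy] does not refer to [n], so a single strategy serves every [n]. *)
by move=> ord ordP; exists greedy => n; apply: greedy_ensures.
Qed.
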